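(* For every positive integer $\mathfrak{s}$ there exists a partial order $\mathcal P$ whose number of siblings, counted up to isomorphism, is exactly $\mathfrak{s}$.
   Context: An embedding of a partial order $(P,\le_P)$ into a partial order $(Q,\le_Q)$ is an injective map $f:P\to Q$ such that for all $x,y\in P$, $x\le_P y$ if and only if $f(x)\le_Q f(y)$. Two partial orders are siblings (equimorphic) if each embeds into the other. The number of siblings of $\mathcal P$ is the number of isomorphism classes of partial orders equimorphic to $\mathcal P$. *)

(* Defs.v *)
From Stdlib Require Import Relation_Definitions FinFun Fin.

Record PartialOrder : Type := {
  carrier :> Type;
  le : relation carrier;
  le_order : order carrier le
}.

Definition is_embedding (P Q : PartialOrder) (f : P -> Q) : Prop :=
  Injective f /\ forall x y : P, le P x y <-> le Q (f x) (f y).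

Definition embeds (P Q : PartialOrder) : Prop :=
  exists f : P -> Q, is_embedding P Q f.

Definition siblings (P Q : PartialOrder) : Prop :=
  embeds P Q /\ embeds Q P.

Definition isomorphic (P Q : PartialOrder) : Prop :=
  exists f : P -> Q,
    Bijective f /\ forall x y : P, le P x y <-> le Q (f x) (f y).

(* The isomorphism classes of siblings of [P] form a set with exactly [n]
   elements: [Q] is a complete system of pairwise non-isomorphic
   representatives. *)
Definition number_of_siblings_is (P : PartialOrder) (n : nat) : Prop :=
  exists Q : Fin.t n -> PartialOrder,
    (forall i, siblings P (Q i)) /\
    (forall i j, isomorphic (Q i) (Q j) -> i = j) /\
    (forall R : PartialOrder, siblings P R -> exists i, isomorphic R (Q i)).

(* Main.v *)
(* Let G be the group of permutations of Z that agree with the translation by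
   some multiple of s off a finite set. The points of the order are columns
   indexed by Z together with the elements of G, placed above the columns. All
   columns are copies of an infinite rigid interval order, except that those
   indexed by a set B of integers contain one additional marker; the set of
   points of the n-th column below c in G encodes the integer c(n). Because the
   columns are rigid and each c is a bijection, an embedding can only permute the
   columns, and it does so by an element of G taking marked columns to marked
   columns. Hence the siblings of the order marked by B = {n >= 0} are the orders
   marked by sets between g(B) and B with g in G. Up to G such a set is determined
   by the size of its complement in B modulo s, which takes all s values. *)

Require Import Defs.
From Stdlib Require Import Relation_Definitions FinFun Fin ZArith Lia List.
From Stdlib Require Import Classical ClassicalEpsilon FunctionalExtensionality.
From Stdlib Require Import ProofIrrelevance.

Open Scope Z_scope.

(** * Permutations of the integers that are eventually translations *)

Definition eventually_shift (t : Z) (g : Z -> Z) : Prop :=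
  exists N, forall n, N <= Z.abs n -> g n = n + t.

Definition inverse_pair (g h : Z -> Z) : Prop :=
  (forall n, h (g n) = n) /\ (forall n, g (h n) = n).

Definition shift_perm (s : Z) (g : Z -> Z) : Prop :=
  (exists k, eventually_shift (s * k) g) /\ exists h, inverse_pair g h.

Lemma eventually_shift_inverse (t : Z) (g h : Z -> Z) :
  inverse_pair g h -> eventually_shift t g -> eventually_shift (- t) h.
Proof.
  intros [hg gh] [N HN]. exists (N + Z.abs t). intros n Hn.
  rewrite <- (hg (n + - t)). f_equal. rewrite HN; lia.
Qed.

Lemma eventually_shift_comp (t u : Z) (g h : Z -> Z) :
  eventually_shift t g -> eventually_shift u h ->
  eventually_shift (t + u) (fun n => g (h n)).
Proof.
  intros [N HN] [M HM]. exists (Z.max M (N + Z.abs u)). intros n Hn.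
  rewrite HM, HN by lia. lia.
Qed.

Lemma shift_perm_id (s : Z) : shift_perm s (fun n => n).
Proof.
  split; [exists 0, 0; intros; lia | exists (fun n => n); now split].
Qed.

Lemma shift_perm_inverse (s : Z) (g h : Z -> Z) :
  inverse_pair g h -> shift_perm s g -> shift_perm s h.
Proof.
  intros gh [[k Hk] _]. split.
  - exists (- k). replace (s * - k) with (- (s * k)) by ring.
    now apply eventually_shift_inverse with g.
  - exists g. destruct gh; now split.
Qed.

Lemma shift_perm_comp (s : Z) (g h : Z -> Z) :
  shift_perm s g -> shift_perm s h -> shift_perm s (fun n => g (h n)).
Proof.
  intros [[k Hk] [g' [g'g gg']]] [[l Hl] [h' [h'h hh']]]. split.
  - exists (k + l). rewrite Z.mul_add_distr_l. now apply eventually_shift_comp.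
  - exists (fun n => h' (g' n)). split; intros n; congruence.
Qed.

Lemma shift_perm_translation (s k : Z) : shift_perm s (fun n => n + s * k).
Proof.
  split.
  - exists k, 0. reflexivity.
  - exists (fun n => n - s * k). split; intros; lia.
Qed.

(** * Counting along rays of integers *)

Definition interval (a b : Z) : list Z :=
  map (fun k => a + Z.of_nat k) (seq 0 (Z.to_nat (b - a))).

Lemma in_interval (a b n : Z) : In n (interval a b) <-> a <= n < b.
Proof.
  unfold interval. rewrite in_map_iff. split.
  - intros [k [<- Hk]]. apply in_seq in Hk. lia.
  - intros H. exists (Z.to_nat (n - a)). rewrite in_seq. lia.
Qed.

Lemma NoDup_interval (a b : Z) : NoDup (interval a b).
Proof.
  apply Injective_map_NoDup; [intros x y; lia | apply seq_NoDup].
Qed.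

Lemma length_interval (a b : Z) : length (interval a b) = Z.to_nat (b - a).
Proof. unfold interval. now rewrite length_map, length_seq. Qed.

(** For large [M], [g] maps [[i, M)] injectively into [[j, M + t)]: a value of at least [M + t] is
    already taken at a point of at least [M], where [g] is the translation. Compare
    cardinalities. *)
Lemma shift_ray_index (t i j : Z) (g : Z -> Z) :
  Injective g -> eventually_shift t g -> (forall n, i <= n -> j <= g n) ->
  j - i <= t.
Proof.
  intros inj [N HN] Hg.
  set (M := Z.abs N + Z.abs i + Z.abs j + Z.abs t).
  assert (H : (length (map g (interval i M)) <= length (interval j (M + t)))%nat).
  { apply NoDup_incl_length.
    - apply Injective_map_NoDup; [exact inj | apply NoDup_interval].
    - intros m Hm. apply in_map_iff in Hm. destruct Hm as [n [<- Hn]].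
      apply in_interval in Hn. apply in_interval. split; [apply Hg; lia|].
      destruct (Z.lt_ge_cases (g n) (M + t)) as [|Hge]; [assumption|].
      assert (n = g n - t) by (apply inj; rewrite (HN (g n - t)); lia). lia. }
  rewrite length_map, !length_interval in H. lia.
Qed.

(** The count for [g] and for its inverse gives [j - i = s * k], while [i] and [j] differ by less
    than [s]. *)
Lemma shift_perm_ray_eq (s i j : Z) (g : Z -> Z) :
  0 <= i < s -> 0 <= j < s -> shift_perm s g ->
  (forall n, i <= n <-> j <= g n) -> i = j.
Proof.
  intros Hi Hj [[k Hk] [h Hgh]] Hray.
  pose proof (eventually_shift_inverse _ _ _ Hgh Hk) as Hk'.
  destruct Hgh as [hg gh].
  assert (j - i <= s * k).
  { apply (shift_ray_index _ _ _ g); [intros x y E; congruence | assumption | apply Hray]. }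
  assert (i - j <= - (s * k)).
  { apply (shift_ray_index _ _ _ h); [intros x y E; congruence | assumption |].
    intros n Hn. apply Hray. now rewrite gh. }
  assert (k = 0) by nia. nia.
Qed.

(** * Straightening a set that is almost a ray *)

Definition swap (a b n : Z) : Z :=
  if n =? a then b else if n =? b then a else n.

Lemma swap_involutive (a b n : Z) : swap a b (swap a b n) = n.
Proof.
  unfold swap. destruct (Z.eqb_spec n a), (Z.eqb_spec n b);
  repeat match goal with |- context [?x =? ?y] => destruct (Z.eqb_spec x y) end; lia.
Qed.

Lemma shift_perm_swap (s a b : Z) : shift_perm s (swap a b).
Proof.
  split.
  - exists 0, (1 + Z.abs a + Z.abs b). intros n Hn. unfold swap.
    destruct (Z.eqb_spec n a), (Z.eqb_spec n b); lia.
  - exists (swap a b). split; intros; apply swap_involutive.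
Qed.

(** Induction on the length [d] of the undecided zone: [B] without [b] is straightened first; if [b]
    is in [B], a transposition then brings its image to [j - 1], just below the ray. *)
Lemma almost_ray_to_ray (s : Z) (d : nat) (b : Z) (B : Z -> Prop) :
  (forall n, B n -> b <= n) -> (forall n, b + Z.of_nat d <= n -> B n) ->
  exists g j, shift_perm s g /\ forall n, B n <-> j <= g n.
Proof.
  revert b B. induction d as [|d IH]; intros b B Hlo Hhi.
  - exists (fun n => n), b. split; [apply shift_perm_id|].
    intros n. split; [apply Hlo | intros; apply Hhi; lia].
  - destruct (IH (b + 1) (fun n => B n /\ n <> b)) as [g [j [Hg Hj]]].
    + intros n [Hn Hb]. apply Hlo in Hn. lia.
    + intros n Hn. split; [apply Hhi; lia | lia].
    + destruct (classic (B b)) as [Hb | Hb].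
      * exists (fun n => swap (g b) (j - 1) (g n)), (j - 1).
        split; [apply shift_perm_comp; [apply shift_perm_swap | assumption]|].
        assert (Hgb : ~ j <= g b) by (rewrite <- Hj; tauto).
        assert (inj : forall n, g n = g b -> n = b).
        { destruct Hg as [_ [h [hg _]]]. intros n E.
          rewrite <- (hg n), E. apply hg. }
        intros n. unfold swap. specialize (Hj n). specialize (inj n).
        destruct (Z.eqb_spec (g n) (g b)) as [E|E].
        { rewrite (inj E). split; [lia | tauto]. }
        assert (n <> b) by congruence.
        destruct (Z.eqb_spec (g n) (j - 1)); [split; intros; [|lia] |].
        { assert (j <= g n) by tauto. lia. }
        { split; intros H'; [assert (j <= g n) by tauto; lia |].
          assert (j <= g n) by lia. tauto. }
      * exists g, j. split; [assumption|]. intros n. rewrite <- Hj.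
        split; [intros Hn; split; [assumption | congruence] | tauto].
Qed.

Lemma almost_ray_classified (s : Z) (N : Z) (B : Z -> Prop) :
  0 < s -> (forall n, B n -> 0 <= n) -> (forall n, N <= n -> B n) ->
  exists g i, shift_perm s g /\ 0 <= i < s /\ forall n, B n <-> i <= g n.
Proof.
  intros Hs Hlo Hhi.
  destruct (almost_ray_to_ray s (Z.to_nat N) 0 B) as [g [j [Hg Hj]]];
    [assumption | intros; apply Hhi; lia |].
  (* Translating by a multiple of [s] replaces the start of the ray by its residue. *)
  exists (fun n => g n + s * (- (j / s))), (j mod s).
  split; [|split; [|intros n]].
  - apply (shift_perm_comp s (fun n => n + s * (- (j / s))));
      [apply shift_perm_translation | assumption].
  - apply Z.mod_pos_bound; lia.
  - rewrite Hj. pose proof (Z.div_mod j s). lia.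
Qed.

(** * Rigid columns *)

(* Each element stands for a closed interval, and a column carries the
   corresponding interval order. [Mark] is the optional element. *)
Inductive column : Type :=
  | Bot1 | Bot2 | Bot3
  | Step (j : nat)
  | Mark.

(** [Step j] is [[j, j + 1]], so successive steps touch and are incomparable. The bots are copies of
    the point 0; the mark is the point 2, incomparable only with [Step 1] and [Step 2]. *)
Definition lo (x : column) : nat :=
  match x with Step j => j | Mark => 2 | _ => 0 end.

Definition hi (x : column) : nat :=
  match x with Step j => S j | Mark => 2 | _ => 0 end.

Definition is_bot (x : column) : Prop := x = Bot1 \/ x = Bot2 \/ x = Bot3.

Definition column_embedding (D : column -> Prop) (a : column -> column) : Prop :=
  (forall x y, D x -> D y -> a x = a y -> x = y) /\
  (forall x y, D x -> D y -> (hi x < lo y)%nat <-> (hi (a x) < lo (a y))%nat).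

(* [Bot1], [Bot2], [Bot3], [Step 0] is the only antichain with four elements;
   from there on incomparability with [Step j] propagates along the steps. *)
Lemma column_embedding_start (D : column -> Prop) (a : column -> column) :
  (forall x, x <> Mark -> D x) -> column_embedding D a ->
  a (Step 0) = Step 0 /\
  is_bot (a Bot1) /\ is_bot (a Bot2) /\ is_bot (a Bot3).
Proof.
  intros HD [inj lt].
  assert (D Bot1 /\ D Bot2 /\ D Bot3 /\ D (Step 0) /\ D (Step 1))
    as [D1 [D2 [D3 [D0 D4]]]] by (repeat split; apply HD; discriminate).
  pose proof (lt Bot1 (Step 0) D1 D0). pose proof (lt (Step 0) Bot1 D0 D1).
  pose proof (lt Bot2 (Step 0) D2 D0). pose proof (lt (Step 0) Bot2 D0 D2).
  pose proof (lt Bot3 (Step 0) D3 D0). pose proof (lt (Step 0) Bot3 D0 D3).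
  pose proof (lt Bot1 Bot2 D1 D2). pose proof (lt Bot2 Bot1 D2 D1).
  pose proof (lt Bot1 Bot3 D1 D3). pose proof (lt Bot3 Bot1 D3 D1).
  pose proof (lt Bot2 Bot3 D2 D3). pose proof (lt Bot3 Bot2 D3 D2).
  (* [Step 1] tells [Step 0] from the bots: it lies above [Bot1] but not above [Step 0], whereas
     anything above one bot is above all of them. *)
  pose proof (lt Bot1 (Step 1) D1 D4).
  pose proof (lt (Step 0) (Step 1) D0 D4). pose proof (lt (Step 1) (Step 0) D4 D0).
  assert (a Bot1 <> a Bot2) by (intros E; now apply inj in E).
  assert (a Bot1 <> a Bot3) by (intros E; now apply inj in E).
  assert (a Bot2 <> a Bot3) by (intros E; now apply inj in E).
  assert (a Bot1 <> a (Step 0)) by (intros E; now apply inj in E).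
  assert (a Bot2 <> a (Step 0)) by (intros E; now apply inj in E).
  assert (a Bot3 <> a (Step 0)) by (intros E; now apply inj in E).
  clear inj lt HD D1 D2 D3 D0 D4. simpl in *. unfold is_bot.
  assert (Step_neq : forall i j, Step i <> Step j -> i <> j) by congruence.
  destruct (a Bot1), (a Bot2); try congruence; simpl in *; try lia;
  destruct (a Bot3); try congruence; simpl in *; try lia;
  destruct (a (Step 0)); try congruence; simpl in *; try lia;
  repeat match goal with
    H : Step _ <> Step _ |- _ => apply Step_neq in H end; try lia;
  (split; [f_equal; lia | tauto]).
Qed.

Lemma column_embedding_steps (D : column -> Prop) (a : column -> column) :
  (forall x, x <> Mark -> D x) -> column_embedding D a ->
  forall j, a (Step j) = Step j.
Proof.
  intros HD Ha. pose proof (column_embedding_start D a HD Ha) as [H0 _].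
  destruct Ha as [_ lt].
  assert (DS : forall j, D (Step j)) by (intros; apply HD; discriminate).
  assert (D1 : D Bot1) by (apply HD; discriminate).
  enough (H : forall j, a (Step j) = Step j /\ a (Step (S j)) = Step (S j))
    by apply H.
  induction j as [|j [IH IH']].
  - split; [exact H0|].
    pose proof (lt Bot1 (Step 1) D1 (DS _)) as L.
    pose proof (lt (Step 0) (Step 1) (DS _) (DS _)) as L'.
    rewrite H0 in L'.
    destruct (a (Step 1)) as [| | |i|]; simpl in L, L'; try lia.
    f_equal; lia.
  - split; [exact IH'|].
    pose proof (lt (Step j) (Step (S (S j))) (DS _) (DS _)) as L.
    pose proof (lt (Step (S j)) (Step (S (S j))) (DS _) (DS _)) as L'.
    (* For [j = 0], [L] and [L'] still allow [Mark] as the image of [Step 2]. It is excluded by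
       [Step 3], which is above [Step 1] but not above [Step 2]: everything above [Step 1] is above
       [Mark]. *)
    pose proof (lt (Step (S j)) (Step (S (S (S j)))) (DS _) (DS _)) as L2.
    pose proof (lt (Step (S (S j))) (Step (S (S (S j)))) (DS _) (DS _)) as L3.
    rewrite IH in L. rewrite IH' in L', L2.
    destruct (a (Step (S (S j)))) as [| | |i|]; simpl in L, L', L2, L3; try lia.
    f_equal; lia.
Qed.

(** Only [Step 2] and [Mark] lie above [Step 0] but not above [Step 1], and [Step 2] is already the
    image of itself. *)
Lemma column_embedding_mark (D : column -> Prop) (a : column -> column) :
  (forall x, x <> Mark -> D x) -> column_embedding D a -> D Mark ->
  a Mark = Mark.
Proof.
  intros HD Ha DM. pose proof (column_embedding_steps D a HD Ha) as HS.
  destruct Ha as [inj lt].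
  assert (DS : forall j, D (Step j)) by (intros; apply HD; discriminate).
  pose proof (lt (Step 0) Mark (DS _) DM) as L.
  pose proof (lt (Step 1) Mark (DS _) DM) as L'.
  rewrite HS in L, L'.
  destruct (a Mark) as [| | |i|] eqn:E; simpl in L, L'; try lia;
    [|reflexivity].
  rewrite <- HS in E. now apply inj in E.
Qed.

Lemma column_embedding_bot_onto (D : column -> Prop) (a : column -> column) :
  (forall x, x <> Mark -> D x) -> column_embedding D a ->
  forall y, is_bot y -> exists x, is_bot x /\ a x = y.
Proof.
  intros HD Ha y Hy.
  destruct (column_embedding_start D a HD Ha) as [_ [H1 [H2 H3]]].
  destruct Ha as [inj _].
  assert (D Bot1 /\ D Bot2 /\ D Bot3) as [D1 [D2 D3]]
    by (repeat split; apply HD; discriminate).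
  assert (a Bot1 <> a Bot2) by (intros E; now apply inj in E).
  assert (a Bot1 <> a Bot3) by (intros E; now apply inj in E).
  assert (a Bot2 <> a Bot3) by (intros E; now apply inj in E).
  assert (a Bot1 = y \/ a Bot2 = y \/ a Bot3 = y) as [E|[E|E]].
  { unfold is_bot in *.
    destruct H1 as [H1|[H1|H1]], H2 as [H2|[H2|H2]]; try congruence;
    destruct H3 as [H3|[H3|H3]]; try congruence;
    destruct Hy as [Hy|[Hy|Hy]]; rewrite H1, H2, H3, Hy; tauto. }
  - exists Bot1. split; [now left | assumption].
  - exists Bot2. split; [now right; left | assumption].
  - exists Bot3. split; [now right; right | assumption].
Qed.

(** * The partial orders *)

(** The zigzag enumeration 0, -1, 1, -2, 2 and so on. *)
Definition code (z : Z) : nat := Z.to_nat (Z.max (2 * z) (- 2 * z - 1)).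

Lemma code_injective : Injective code.
Proof. intros x y. unfold code. lia. Qed.

Inductive point (s : Z) : Type :=
  | Perm (c : {g : Z -> Z | shift_perm s g})
  | Col (n : Z) (x : column).

Arguments Perm {s} c.
Arguments Col {s} n x.

(** [Step j] of column [n] lies below [Perm c] exactly when [j < code (c n)], so the order
    determines every value of [c]. The bots lie below every [Perm]. *)
Definition lt_point {s : Z} (p q : point s) : Prop :=
  match p, q with
  | Col n x, Col m y => n = m /\ (hi x < lo y)%nat
  | Col n x, Perm c => (hi x <= code (proj1_sig c n))%nat
  | Perm _, _ => False
  end.

Lemma lo_le_hi (x : column) : (lo x <= hi x)%nat.
Proof. destruct x; simpl; lia. Qed.

Lemma lt_point_irrefl {s : Z} (p : point s) : ~ lt_point p p.
Proof.
  destruct p as [c|n x]; simpl; [tauto|]. pose proof (lo_le_hi x). lia.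
Qed.

Lemma lt_point_trans {s : Z} (p q r : point s) :
  lt_point p q -> lt_point q r -> lt_point p r.
Proof.
  destruct p as [c|n x], q as [d|m y], r as [e|l z]; simpl; try tauto.
  - intros [-> H] H'. pose proof (lo_le_hi y). lia.
  - intros [-> H] [-> H']. pose proof (lo_le_hi y). lia.
Qed.

Definition marked_at {s : Z} (B : Z -> Prop) (p : point s) : Prop :=
  match p with Col n Mark => B n | _ => True end.

Lemma sub_point_order {s : Z} (S : point s -> Prop) :
  order {p | S p} (fun p q => p = q \/ lt_point (proj1_sig p) (proj1_sig q)).
Proof.
  split.
  - intros p. now left.
  - intros p q r [->|H] [->|H']; auto. right. now apply lt_point_trans with (proj1_sig q).
  - intros p q [->|H] [E|H']; auto.
    exfalso. apply (lt_point_irrefl (proj1_sig p)). now apply lt_point_trans with (proj1_sig q).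
Qed.

Definition marked_order (s : Z) (B : Z -> Prop) : PartialOrder :=
  {| carrier := {p : point s | marked_at B p};
     le := fun p q => p = q \/ lt_point (proj1_sig p) (proj1_sig q);
     le_order := sub_point_order _ |}.

Lemma sig_ext {T : Type} (S : T -> Prop) (u v : {x | S x}) :
  proj1_sig u = proj1_sig v -> u = v.
Proof. intros E. apply eq_sig_hprop; [intros; apply proof_irrelevance | exact E]. Qed.

Lemma Perm_ext (s : Z) (c d : {g : Z -> Z | shift_perm s g}) :
  (forall n, proj1_sig c n = proj1_sig d n) -> c = d.
Proof. intros E. apply sig_ext. now apply functional_extensionality. Qed.

(** * Embeddings *)

(** Embeddings as total maps on raw points, constrained only at points present in the order, so that
    case analysis on constructors involves no membership proofs. *)
Definition point_embedding {s : Z} (B B' : Z -> Prop) (f : point s -> point s) : Prop :=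
  (forall p, marked_at B p -> marked_at B' (f p)) /\
  (forall p q, marked_at B p -> marked_at B q -> f p = f q -> p = q) /\
  (forall p q, marked_at B p -> marked_at B q -> lt_point p q <-> lt_point (f p) (f q)).

Lemma sig_fun_extend {T U : Type} (S : T -> Prop) (F : {x | S x} -> U) (d : U) :
  exists f : T -> U, forall u, f (proj1_sig u) = F u.
Proof.
  exists (fun x => match excluded_middle_informative (S x) with
                   | left H => F (exist _ x H) | right _ => d end).
  intros u. destruct (excluded_middle_informative _) as [H|H].
  - f_equal. now apply sig_ext.
  - destruct H. apply proj2_sig.
Qed.

Lemma point_embedding_of_embedding (s : Z) (B B' : Z -> Prop)
    (F : marked_order s B -> marked_order s B') :
  is_embedding _ _ F ->
  exists f, point_embedding B B' f /\ forall u, f (proj1_sig u) = proj1_sig (F u).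
Proof.
  intros [inj Hle].
  destruct (sig_fun_extend _ (fun u => proj1_sig (F u)) (Col 0 Bot1)) as [f Hf].
  exists f. split; [|exact Hf]. split; [|split].
  - intros p Hp. change p with (proj1_sig (exist _ p Hp)). rewrite Hf. apply proj2_sig.
  - intros p q Hp Hq.
    change (f (proj1_sig (exist _ p Hp)) = f (proj1_sig (exist _ q Hq)) ->
            proj1_sig (exist _ p Hp) = proj1_sig (exist _ q Hq)).
    rewrite !Hf. intros E. apply sig_ext, inj in E. now rewrite E.
  - intros p q Hp Hq.
    change (lt_point (proj1_sig (exist _ p Hp)) (proj1_sig (exist _ q Hq)) <->
      lt_point (f (proj1_sig (exist _ p Hp))) (f (proj1_sig (exist _ q Hq)))).
    set (u := exist _ p Hp : marked_order s B).
    set (v := exist _ q Hq : marked_order s B).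
    rewrite !Hf. specialize (Hle u v). simpl in Hle. split; intros H.
    + destruct Hle as [[E|H'] _]; [now right | | assumption].
      apply inj in E. rewrite E in H. now apply lt_point_irrefl in H.
    + destruct Hle as [_ [E|H']]; [now right | | assumption].
      rewrite E in H. now apply lt_point_irrefl in H.
Qed.

(* [Perm]s are maximal whereas every column element has upper bounds in its
   column, so columns go into columns. *)
Lemma point_embedding_columns (s : Z) (B B' : Z -> Prop) (f : point s -> point s) :
  point_embedding B B' f ->
  exists (phi : Z -> Z) (a : Z -> column -> column),
    (forall n x, marked_at (s := s) B (Col n x) -> f (Col n x) = Col (phi n) (a n x)) /\
    (forall n, column_embedding (fun x => marked_at (s := s) B (Col n x)) (a n)).
Proof.
  intros [_ [inj lt]].
  (* The image of [Step 0] names the target column; the [Perm] branches are placeholders, not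
     reached at points that are present. *)
  exists (fun n => match f (Col n (Step 0)) with Col m _ => m | Perm _ => 0 end).
  exists (fun n x => match f (Col n x) with Col _ y => y | Perm _ => Mark end).
  assert (Hcol : forall n x, marked_at (s := s) B (Col n x) -> f (Col n x) =
    Col (match f (Col n (Step 0)) with Col m _ => m | Perm _ => 0 end)
        (match f (Col n x) with Col _ y => y | Perm _ => Mark end)).
  { intros n x Hx.
    (* [Step (hi x + 2)] is above both [x] and [Step 0], and by [L3] its image is not maximal; so
       all three images lie in one column. *)
    assert (L1 : lt_point (f (Col n x)) (f (Col n (Step (S (S (hi x))))))).
    { apply (lt _ (Col n (Step _)) Hx I); split; simpl; lia. }
    assert (L2 : lt_point (f (Col n (Step 0))) (f (Col n (Step (S (S (hi x))))))).
    { apply (lt (Col n (Step _)) (Col n (Step _)) I I); split; simpl; lia. }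
    assert (L3 : lt_point (f (Col n (Step (S (S (hi x))))))
                   (f (Col n (Step (S (S (S (S (hi x))))))))).
    { apply (lt (Col n (Step _)) (Col n (Step _)) I I); split; simpl; lia. }
    destruct (f (Col n x)) as [|m y]; [contradiction|].
    destruct (f (Col n (Step 0))) as [|m' y']; [contradiction|].
    destruct (f (Col n (Step (S (S (hi x)))))) as [|m'' y'']; [contradiction|].
    simpl in L1, L2. f_equal. destruct L1, L2. congruence. }
  split; [exact Hcol|].
  intros n. split.
  - intros x y Hx Hy E. pose proof (Hcol n x Hx) as E1. pose proof (Hcol n y Hy) as E2.
    rewrite E in E1. rewrite <- E2 in E1. apply inj in E1; [|assumption..]. congruence.
  - intros x y Hx Hy. specialize (lt (Col n x) (Col n y) Hx Hy).
    rewrite (Hcol n x Hx), (Hcol n y Hy) in lt. simpl in lt. tauto.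
Qed.

(** All the freedom left to an embedding: a group element [phi] moving the columns and, by
    composition with its inverse, the [Perm]s, together with a permutation of the three bots in each
    column. *)
Record rigid_data {s : Z} (B : Z -> Prop) (f : point s -> point s) (phi : Z -> Z) : Prop := {
  rigid_perm : shift_perm s phi;
  rigid_Perm : forall c, exists d,
    f (Perm c) = Perm d /\ forall n, proj1_sig d (phi n) = proj1_sig c n;
  rigid_step : forall n j, f (Col n (Step j)) = Col (phi n) (Step j);
  rigid_bot : forall n x, is_bot x -> exists y, is_bot y /\ f (Col n x) = Col (phi n) y;
  rigid_bot_onto : forall n y, is_bot y -> exists x, is_bot x /\ f (Col n x) = Col (phi n) y;
  rigid_mark : forall n, B n -> f (Col n Mark) = Col (phi n) Mark
}.

(** A [Perm] has points of several columns below it, so it cannot go into a column; comparing its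
    image with the steps forces [d (phi n) = c n]. *)
Lemma point_embedding_rigid (s : Z) (B B' : Z -> Prop) (f : point s -> point s) :
  point_embedding B B' f -> exists phi, rigid_data B f phi.
Proof.
  intros Hf. destruct (point_embedding_columns s B B' f Hf) as [phi [a [Hcol Ha]]].
  exists phi. destruct Hf as [_ [inj lt]].
  assert (HD : forall n x, x <> Mark -> marked_at (s := s) B (Col n x))
    by (intros n [] Hx; exact I || now destruct Hx).
  assert (Hstep : forall n j, f (Col n (Step j)) = Col (phi n) (Step j)).
  { intros n j. rewrite Hcol by exact I. f_equal.
    now apply (column_embedding_steps _ _ (HD n) (Ha n)). }
  assert (phi_inj : Injective phi).
  { intros n m E. assert (E' : Col n (Step 0) = Col (s := s) m (Step 0)).
    { apply inj; [exact I.. |]. rewrite !Hstep. now rewrite E. }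
    now injection E'. }
  assert (HPerm : forall c, exists d,
    f (Perm c) = Perm d /\ forall n, proj1_sig d (phi n) = proj1_sig c n).
  { intros c.
    assert (L : forall n, lt_point (f (Col n Bot1)) (f (Perm c)))
      by (intros; apply (lt (Col _ Bot1) (Perm c) I I); simpl; lia).
    destruct (f (Perm c)) as [d|m y] eqn:E.
    - exists d. split; [reflexivity|]. intros n. apply code_injective.
      assert (H : forall j, (S j <= code (proj1_sig c n))%nat <->
                            (S j <= code (proj1_sig d (phi n)))%nat).
      { intros j. specialize (lt (Col n (Step j)) (Perm c) I I).
        rewrite Hstep, E in lt. exact lt. }
      (* Testing [H] at and just below both thresholds makes them equal. *)
      pose proof (H (code (proj1_sig c n))). pose proof (H (code (proj1_sig d (phi n)))).
      pose proof (H (pred (code (proj1_sig c n)))).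
      pose proof (H (pred (code (proj1_sig d (phi n))))). lia.
    - exfalso. pose proof (L 0) as L0. pose proof (L 1) as L1.
      rewrite Hcol in L0, L1 by exact I. destruct L0 as [L0 _], L1 as [L1 _].
      assert (0 = 1) by (apply phi_inj; congruence). discriminate. }
  split.
  - (* [phi] inverts the permutation to which the identity is sent. *)
    destruct (HPerm (exist _ _ (shift_perm_id s))) as [[d Hd] [_ H]]. simpl in H.
    apply (shift_perm_inverse s d); [|assumption].
    destruct Hd as [_ [h [hd dh]]]. split; [|exact H].
    intros n. rewrite <- (hd (phi (d n))), H. apply hd.
  - exact HPerm.
  - exact Hstep.
  - intros n x Hx. exists (a n x).
    destruct (column_embedding_start _ _ (HD n) (Ha n)) as [_ [H1 [H2 H3]]].
    split; [now destruct Hx as [->|[->| ->]]|].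
    apply Hcol, HD. now destruct Hx as [->|[->| ->]].
  - intros n y Hy.
    destruct (column_embedding_bot_onto _ _ (HD n) (Ha n) y Hy) as [x [Hx E]].
    exists x. split; [assumption|]. rewrite <- E.
    apply Hcol, HD. now destruct Hx as [->|[->| ->]].
  - intros n Hn. rewrite Hcol by exact Hn. f_equal.
    now apply (column_embedding_mark _ _ (HD n) (Ha n)).
Qed.

Lemma rigid_onto_unmarked (s : Z) (B : Z -> Prop) (f : point s -> point s) (phi : Z -> Z) :
  rigid_data B f phi ->
  forall q, (forall n, q <> Col n Mark) -> exists p, marked_at B p /\ f p = q.
Proof.
  intros R q Hq. pose proof (rigid_perm _ _ _ R) as Hphi.
  pose proof Hphi as [_ [h [hphi phih]]]. destruct q as [d|m y].
  (* The preimage of [d] is [d] after [phi]: its image [d'] agrees with [d] on the range of [phi],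
     which is everything. *)
  - set (c := exist _ _ (shift_perm_comp s _ _ (proj2_sig d) Hphi)).
    exists (Perm c). split; [exact I|].
    destruct (rigid_Perm _ _ _ R c) as [d' [-> H]]. f_equal. apply Perm_ext.
    intros n. rewrite <- (phih n), H. reflexivity.
  - assert (is_bot y \/ exists j, y = Step j) as [Hy|[j ->]].
    { destruct y; unfold is_bot; eauto. now destruct (Hq m). }
    + destruct (rigid_bot_onto _ _ _ R (h m) y Hy) as [x [Hx E]].
      exists (Col (h m) x). rewrite phih in E. split; [|assumption].
      now destruct Hx as [->|[->| ->]].
    + exists (Col (h m) (Step j)). split; [exact I|].
      rewrite (rigid_step _ _ _ R). now rewrite phih.
Qed.

(** Bots, steps and [Perm]s keep their kind, so only a mark can go to a mark; injectivity of [phi]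
    gives its column. *)
Lemma rigid_mark_preimage (s : Z) (B : Z -> Prop) (f : point s -> point s) (phi : Z -> Z) :
  rigid_data B f phi ->
  forall p m, marked_at B p -> f p = Col (phi m) Mark -> B m.
Proof.
  intros R p m Hp E. pose proof (rigid_perm _ _ _ R) as [_ [h [hphi _]]].
  assert (Hb : forall n x, is_bot x -> f (Col n x) <> Col (phi m) Mark).
  { intros n x Hx. destruct (rigid_bot _ _ _ R n x Hx) as [y [Hy ->]].
    destruct Hy as [->|[->| ->]]; discriminate. }
  destruct p as [c|n x].
  - destruct (rigid_Perm _ _ _ R c) as [d [E' _]]. congruence.
  - destruct x; try (exfalso; eapply Hb; [|exact E]; unfold is_bot; tauto).
    + rewrite (rigid_step _ _ _ R) in E. discriminate.
    + rewrite (rigid_mark _ _ _ R n Hp) in E. injection E as E.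
      simpl in Hp. rewrite <- (hphi m), <- E, hphi. exact Hp.
Qed.

(** * Siblings *)

Lemma bijective_of_inj_surj {T U : Type} (f : T -> U) :
  Injective f -> (forall y, exists x, f x = y) -> Bijective f.
Proof.
  intros inj surj.
  exists (fun y => proj1_sig (constructive_indefinite_description _ (surj y))).
  assert (H : forall y, f (proj1_sig (constructive_indefinite_description _ (surj y))) = y)
    by (intros; apply proj2_sig).
  split; [intros x; apply inj, H | exact H].
Qed.

Lemma isomorphic_trans (P Q R : PartialOrder) :
  isomorphic P Q -> isomorphic Q R -> isomorphic P R.
Proof.
  intros [f [[f' [f'f ff']] Hf]] [g [[g' [g'g gg']] Hg]].
  exists (fun x => g (f x)). split.
  - exists (fun x => f' (g' x)). split; intros; congruence.
  - intros x y. now rewrite Hf, Hg.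
Qed.

Lemma isomorphic_embeds (P Q : PartialOrder) : isomorphic P Q -> embeds P Q.
Proof.
  intros [f [[f' [f'f ff']] Hf]]. exists f. split; [|assumption].
  intros x y E. congruence.
Qed.

Lemma embeds_trans (P Q R : PartialOrder) : embeds P Q -> embeds Q R -> embeds P R.
Proof.
  intros [f [fi Hf]] [g [gi Hg]]. exists (fun x => g (f x)). split.
  - intros x y E. now apply fi, gi.
  - intros x y. now rewrite Hf, Hg.
Qed.

Lemma marked_order_subset (s : Z) (B B' : Z -> Prop) :
  (forall n, B n -> B' n) -> embeds (marked_order s B) (marked_order s B').
Proof.
  intros H.
  assert (Hm : forall p : point s, marked_at B p -> marked_at B' p)
    by (intros [c|n []]; simpl; auto).
  exists (fun u => exist _ (proj1_sig u) (Hm _ (proj2_sig u))). split.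
  - intros u v E. apply sig_ext. apply (f_equal (@proj1_sig _ _)) in E. exact E.
  - intros u v. simpl. split; (intros [E|L]; [left | now right]).
    + now rewrite E.
    + apply sig_ext. apply (f_equal (@proj1_sig _ _)) in E. exact E.
Qed.

(** Column [n] moves to [g n] and [c] becomes [c] after the inverse of [g], so the threshold in the
    moved column is still [code (c n)]. *)
Lemma marked_order_perm (s : Z) (B B' : Z -> Prop) (g : Z -> Z) :
  shift_perm s g -> (forall n, B n <-> B' (g n)) ->
  isomorphic (marked_order s B) (marked_order s B').
Proof.
  intros Hg HB. pose proof Hg as [_ [h Hgh]].
  pose proof (shift_perm_inverse s g h Hgh Hg) as Hh. destruct Hgh as [hg gh].
  set (F := fun p : point s => match p with
    | Perm c => Perm (exist _ _ (shift_perm_comp s _ _ (proj2_sig c) Hh))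
    | Col n x => Col (g n) x end).
  set (F' := fun p : point s => match p with
    | Perm c => Perm (exist _ _ (shift_perm_comp s _ _ (proj2_sig c) Hg))
    | Col n x => Col (h n) x end).
  assert (FF' : forall p, F (F' p) = p).
  { intros [c|n x]; simpl; f_equal; auto. apply Perm_ext. intros n. simpl. now rewrite gh. }
  assert (F'F : forall p, F' (F p) = p).
  { intros [c|n x]; simpl; f_equal; auto. apply Perm_ext. intros n. simpl. now rewrite hg. }
  assert (HF : forall p, marked_at B p -> marked_at B' (F p)).
  { intros [c|n []]; simpl; auto. apply HB. }
  assert (HF' : forall p, marked_at B' p -> marked_at B (F' p)).
  { intros [c|n []]; simpl; auto. rewrite HB, gh. auto. }
  assert (Hlt : forall p q, lt_point p q <-> lt_point (F p) (F q)).
  { intros [c|n x] [d|m y]; simpl; try tauto.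
    - now rewrite hg.
    - split; intros [E L]; split; congruence. }
  exists (fun u => exist _ (F (proj1_sig u)) (HF _ (proj2_sig u))). split.
  - exists (fun u => exist _ (F' (proj1_sig u)) (HF' _ (proj2_sig u))).
    split; intros u; apply sig_ext; simpl; auto.
  - intros u v. simpl. rewrite <- Hlt. split; (intros [E|L]; [left | now right]).
    + now rewrite E.
    + apply sig_ext. apply (f_equal (@proj1_sig _ _)) in E.
      rewrite <- (F'F (proj1_sig u)), <- (F'F (proj1_sig v)).
      exact (f_equal F' E).
Qed.

Lemma marked_order_isomorphic (s : Z) (B B' : Z -> Prop) :
  isomorphic (marked_order s B) (marked_order s B') ->
  exists g, shift_perm s g /\ forall n, B n <-> B' (g n).
Proof.
  intros [F [[F' [F'F FF']] HF]].
  destruct (point_embedding_of_embedding s B B' F) as [f [Hf E]].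
  { split; [intros x y Exy; congruence | assumption]. }
  destruct (point_embedding_rigid s B B' f Hf) as [phi R].
  exists phi. split; [apply (rigid_perm _ _ _ R)|]. intros n. split; intros Hn.
  - pose proof (proj1 Hf (Col n Mark) Hn) as H.
    now rewrite (rigid_mark _ _ _ R n Hn) in H.
  - set (v := exist _ (Col (phi n) Mark) Hn : marked_order s B').
    apply (rigid_mark_preimage _ _ _ _ R (proj1_sig (F' v)) n (proj2_sig (F' v))).
    now rewrite E, FF'.
Qed.

(** [R] is identified with its image under [H]. That image contains the image of the rigid
    self-embedding [H (G u)], hence every unmarked point, so only the set [B] of its marks is
    free. *)
Lemma sibling_of_marked_order (s : Z) (A : Z -> Prop) (R : PartialOrder) :
  siblings (marked_order s A) R ->
  exists (B : Z -> Prop) (phi : Z -> Z), shift_perm s phi /\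
    (forall n, A n -> B (phi n)) /\ (forall n, B n -> A n) /\
    isomorphic R (marked_order s B).
Proof.
  intros [[G [Gi HG]] [H [Hi HH]]].
  destruct (point_embedding_of_embedding s A A (fun u => H (G u))) as [f [Hf E]].
  { split; [intros x y Exy; now apply Gi, Hi | intros x y; now rewrite HG, HH]. }
  destruct (point_embedding_rigid s A A f Hf) as [phi Rf].
  set (B := fun n => exists r, proj1_sig (H r) = Col n Mark).
  exists B, phi. split; [apply (rigid_perm _ _ _ Rf)|]. split; [|split].
  - intros n Hn. exists (G (exist _ (Col n Mark) Hn)).
    rewrite <- E. simpl. now apply (rigid_mark _ _ _ Rf).
  - intros n [r Hr]. pose proof (proj2_sig (H r)) as HA. simpl in HA.
    now rewrite Hr in HA.
  - assert (HB : forall r, marked_at B (proj1_sig (H r))).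
    { intros r. destruct (proj1_sig (H r)) as [c|n []] eqn:Er; simpl; auto. now exists r. }
    exists (fun r => exist _ (proj1_sig (H r)) (HB r)). split.
    + apply bijective_of_inj_surj.
      * intros x y Exy. apply Hi, sig_ext. exact (f_equal (@proj1_sig _ _) Exy).
      * intros [q Hq].
        assert (Hex : exists r, proj1_sig (H r) = q).
        { destruct (classic (exists n, q = Col n Mark)) as [[n ->]|Hn]; [exact Hq|].
          destruct (rigid_onto_unmarked _ _ _ _ Rf q) as [p [Hp <-]];
            [intros n En; apply Hn; now exists n |].
          exists (G (exist _ p Hp)). now rewrite <- E. }
        destruct Hex as [r Hr]. exists r. now apply sig_ext.
    + intros x y. rewrite HH. simpl. split; (intros [Exy|L]; [left | now right]).
      * now apply sig_ext; simpl; rewrite Exy.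
      * apply sig_ext. exact (f_equal (@proj1_sig _ _) Exy).
Qed.

(** * The siblings of the order marked by a ray *)

Lemma sibling_of_ray (s : Z) (R : PartialOrder) :
  0 < s -> siblings (marked_order s (Z.le 0)) R ->
  exists i, 0 <= i < s /\ isomorphic R (marked_order s (Z.le i)).
Proof.
  intros Hs HR.
  destruct (sibling_of_marked_order s (Z.le 0) R HR) as [B [phi [Hphi [HA [HB Hiso]]]]].
  destruct Hphi as [[k [N HN]] _].
  (* Beyond this bound [n - s * k] is nonnegative and [phi] translates it to [n], so [n] is in
     [B]. *)
  destruct (almost_ray_classified s (Z.abs N + Z.abs (s * k)) B Hs) as [g [i [Hg [Hi HBi]]]].
  - exact HB.
  - intros n Hn. replace n with (phi (n - s * k)) by (rewrite HN; lia).
    apply HA. lia.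
  - exists i. split; [assumption|].
    apply (isomorphic_trans _ _ _ Hiso). now apply marked_order_perm with g.
Qed.

(** Translation by [s] carries the ray from 0 onto the ray from [s], which lies inside the ray from
    [i]. *)
Lemma ray_siblings (s i : Z) :
  0 <= i < s -> siblings (marked_order s (Z.le 0)) (marked_order s (Z.le i)).
Proof.
  intros Hi. split; [|apply marked_order_subset; lia].
  apply embeds_trans with (marked_order s (Z.le s));
    [|apply marked_order_subset; lia].
  apply isomorphic_embeds, marked_order_perm with (fun n => n + s * 1);
    [apply shift_perm_translation | lia].
Qed.

Close Scope Z_scope.

Theorem theorem1p2 (s : nat) (hs : 0 < s) :
  exists P : PartialOrder, number_of_siblings_is P s.
Proof.
  exists (marked_order (Z.of_nat s) (Z.le 0)).
  set (index := fun i : Fin.t s => Z.of_nat (proj1_sig (Fin.to_nat i))).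
  assert (Hindex : forall i, (0 <= index i < Z.of_nat s)%Z).
  { intros i. unfold index. destruct (Fin.to_nat i) as [k Hk]. simpl. lia. }
  (* One ray for each residue modulo [s]. *)
  exists (fun i => marked_order (Z.of_nat s) (Z.le (index i))). split; [|split].
  - intros i. now apply ray_siblings.
  - intros i j Hij. apply marked_order_isomorphic in Hij.
    destruct Hij as [g [Hg Hray]]. apply Fin.to_nat_inj, Nat2Z.inj.
    exact (shift_perm_ray_eq _ _ _ g (Hindex i) (Hindex j) Hg Hray).
  - intros R HR. apply sibling_of_ray in HR; [|lia].
    destruct HR as [i [Hi Hiso]].
    assert (Hlt : Z.to_nat i < s) by lia.
    exists (Fin.of_nat_lt Hlt). unfold index. rewrite Fin.to_nat_of_nat. simpl.
    now rewrite Z2Nat.id by lia.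
Qed.
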